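(* A set $G$ is a group (i.e. admits a group structure) if and only if the functor $\mathrm{Map}(G,-):\mathbf{Set}\to\mathbf{Set}$ is a Hopf monad (i.e. admits the structure of a bimonad with an antipode).
   Context: $\mathrm{Map}(G,X)$ is the set of all maps $G\to X$; the functor $\mathrm{Map}(G,-)$ is right adjoint to $G\times-$. A bimonad on a category $\mathbb{A}$ is an endofunctor $H:\mathbb{A}\to\mathbb{A}$ with a monad structure $(H,m:HH\to H,e:1\to H)$, a comonad structure $(H,\delta:H\to HH,\varepsilon:H\to 1)$ and a natural transformation $\lambda:HH\to HH$ such that: (i) $\varepsilon\cdot e=1$ and $\varepsilon\cdot m=\varepsilon\cdot H\varepsilon$; (ii) $\delta\cdot e=eH\cdot e$; (iii) $\lambda$ is a mixed distributive law from the monad to the comonad, i.e. $\lambda\cdot eH=He$, $\varepsilon H\cdot\lambda=H\varepsilon$, $\delta H\cdot\lambda=H\lambda\cdot\lambda H\cdot H\delta$, $\lambda\cdot mH=Hm\cdot\lambda H\cdot H\lambda$; and $\delta\cdot m=Hm\cdot\lambda H\cdot H\delta$. Here $\cdot$ is vertical composition and juxtaposition with $H$ is whiskering. An antipode is a natural transformation $S:H\to H$ with $m\cdot SH\cdot\delta=e\cdot\varepsilon=m\cdot HS\cdot\delta$. A Hopf monad is a bimonad which has an antipode. *)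

(* Defs.v *)
From mathcomp Require Import ssreflect ssrfun.

Set Implicit Arguments.
Unset Strict Implicit.
Unset Printing Implicit Defensive.

Declare Scope cat_scope.
Delimit Scope cat_scope with cat.

(** ** Categories, functors, natural transformations *)

Record category := Category {
  obj :> Type;
  hom : obj -> obj -> Type;
  idmap : forall X, hom X X;
  comp : forall X Y Z, hom Y Z -> hom X Y -> hom X Z;
  comp_idl : forall X Y (f : hom X Y), comp (idmap Y) f = f;
  comp_idr : forall X Y (f : hom X Y), comp f (idmap X) = f;
  comp_assoc : forall W X Y Z (h : hom Y Z) (g : hom X Y) (f : hom W X),
    comp h (comp g f) = comp (comp h g) f
}.

Arguments idmap {c} X.
Arguments comp {c X Y Z} g f.

Notation "g ∘ f" := (comp g f) (at level 40, left associativity) : cat_scope.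
Local Open Scope cat_scope.

Record functor (A B : category) := Functor {
  fobj :> A -> B;
  fmap : forall X Y, hom X Y -> hom (fobj X) (fobj Y);
  fmap_id : forall X, fmap (idmap X) = idmap (fobj X);
  fmap_comp : forall X Y Z (g : hom Y Z) (f : hom X Y),
    fmap (g ∘ f) = fmap g ∘ fmap f
}.

Arguments fmap {A B} F {X Y} f : rename.

Definition id_functor (A : category) : functor A A :=
  {| fobj := fun X => X;
     fmap := fun _ _ f => f;
     fmap_id := fun X => erefl;
     fmap_comp := fun X Y Z g f => erefl |}.

Section Composition.

Variables (A B C : category) (G : functor B C) (F : functor A B).

Let gf_map X Y (f : hom X Y) := fmap G (fmap F f).

Fact comp_functor_id X : gf_map (idmap X) = idmap (G (F X)).
Proof. by rewrite /gf_map !fmap_id. Qed.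

Fact comp_functor_comp X Y Z (g : hom Y Z) (f : hom X Y) :
  gf_map (g ∘ f) = gf_map g ∘ gf_map f.
Proof. by rewrite /gf_map !fmap_comp. Qed.

Definition comp_functor : functor A C :=
  {| fobj := fun X => G (F X);
     fmap := fun _ _ f => fmap G (fmap F f);
     fmap_id := comp_functor_id;
     fmap_comp := comp_functor_comp |}.

End Composition.

Record nat_trans (A B : category) (F G : functor A B) := NatTrans {
  component :> forall X : A, hom (F X) (G X);
  naturality : forall X Y (f : hom X Y),
    component Y ∘ fmap F f = fmap G f ∘ component X
}.

(** ** Monads, comonads, bimonads, antipodes

    Equations between natural transformations are stated componentwise: the
    component at [X] of the whiskering [H alpha] is [fmap H (alpha X)], that of
    [alpha H] is [alpha (H X)], and vertical composition is [∘] at each [X]. *)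

Section Bimonads.

Variables (A : category) (H : functor A A).

Record monad := Monad {
  mult : nat_trans (comp_functor H H) H;
  unit : nat_trans (id_functor A) H;
  mult_assoc : forall X, mult X ∘ fmap H (mult X) = mult X ∘ mult (H X);
  mult_unitl : forall X, mult X ∘ unit (H X) = idmap (H X);
  mult_unitr : forall X, mult X ∘ fmap H (unit X) = idmap (H X)
}.

Record comonad := Comonad {
  comult : nat_trans H (comp_functor H H);
  counit : nat_trans H (id_functor A);
  comult_coassoc : forall X,
    fmap H (comult X) ∘ comult X = comult (H X) ∘ comult X;
  comult_counitl : forall X, counit (H X) ∘ comult X = idmap (H X);
  comult_counitr : forall X, fmap H (counit X) ∘ comult X = idmap (H X)
}.

Record mixed_distributive_law (M : monad) (C : comonad)
    (lam : nat_trans (comp_functor H H) (comp_functor H H)) : Prop := {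
  mdl_unit : forall X, lam X ∘ unit M (H X) = fmap H (unit M X);
  mdl_counit : forall X, counit C (H X) ∘ lam X = fmap H (counit C X);
  mdl_comult : forall X,
    comult C (H X) ∘ lam X =
    fmap H (lam X) ∘ lam (H X) ∘ fmap H (comult C X);
  mdl_mult : forall X,
    lam X ∘ mult M (H X) =
    fmap H (mult M X) ∘ lam (H X) ∘ fmap H (lam X)
}.

Record bimonad := Bimonad {
  bimonad_monad :> monad;
  bimonad_comonad :> comonad;
  entwining : nat_trans (comp_functor H H) (comp_functor H H);
  counit_unit : forall X,
    counit bimonad_comonad X ∘ unit bimonad_monad X = idmap X;
  counit_mult : forall X,
    counit bimonad_comonad X ∘ mult bimonad_monad X =
    counit bimonad_comonad X ∘ fmap H (counit bimonad_comonad X);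
  comult_unit : forall X,
    comult bimonad_comonad X ∘ unit bimonad_monad X =
    unit bimonad_monad (H X) ∘ unit bimonad_monad X;
  entwining_law :
    mixed_distributive_law bimonad_monad bimonad_comonad entwining;
  comult_mult : forall X,
    comult bimonad_comonad X ∘ mult bimonad_monad X =
    fmap H (mult bimonad_monad X) ∘ entwining (H X)
      ∘ fmap H (comult bimonad_comonad X)
}.

Record antipode (B : bimonad) (S : nat_trans H H) : Prop := {
  antipodel : forall X,
    mult B X ∘ S (H X) ∘ comult B X = unit B X ∘ counit B X;
  antipoder : forall X,
    mult B X ∘ fmap H (S X) ∘ comult B X = unit B X ∘ counit B X
}.

Definition is_hopf_monad : Prop :=
  exists B : bimonad, exists S : nat_trans H H, antipode B S.

End Bimonads.

(** ** The category of sets and the functor [Map(G, -)] *)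

Definition Sets : category :=
  {| obj := Type;
     hom := fun X Y => X -> Y;
     idmap := fun X x => x;
     comp := fun X Y Z g f x => g (f x);
     comp_idl := fun X Y f => erefl;
     comp_idr := fun X Y f => erefl;
     comp_assoc := fun W X Y Z h g f => erefl |}.

Definition Map (G : Sets) : functor Sets Sets :=
  {| fobj := (fun X => G -> X) : Sets -> Sets;
     fmap := fun X Y (f : X -> Y) (phi : G -> X) g => f (phi g);
     fmap_id := fun X => erefl;
     fmap_comp := fun X Y Z g f => erefl |}.

(** ** Group structures on a set

    MathComp's [groupType] also carries decidable equality and a choice
    operator, which an arbitrary set [G] does not come with. *)

Record group_structure (G : Type) := GroupStructure {
  gmul : G -> G -> G;
  gone : G;
  ginv : G -> G;
  gmulA : associative gmul;
  gmul1g : left_id gone gmul;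
  gmulg1 : right_id gone gmul;
  gmulVg : left_inverse gone ginv gmul;
  gmulgV : right_inverse gone ginv gmul
}.

Definition is_group (G : Type) : Prop := inhabited (group_structure G).

(* Main.v *)
Require Import Defs.
From mathcomp Require Import ssreflect ssrfun.
From Stdlib Require Import FunctionalExtensionality.

Set Implicit Arguments.
Unset Strict Implicit.
Unset Printing Implicit Defensive.

(** The functor [Map G] is represented by [G], and its iterate [Map G ∘ Map G]
    by [G * G]. By the Yoneda lemma, natural transformations between iterates
    of [Map G] are therefore precompositions with maps between powers of [G], in
    the opposite direction: [comult] is precomposition with a binary operation
    on [G], [counit] evaluation at a point, and an antipode precomposition with
    a unary operation, while the data of a monad amount to a comonoid structure
    on the set [G].

    A set carries exactly one comonoid structure, the diagonal, so the monad of
    a bimonad on [Map G] is forced: [unit] gives constant maps ([unit_Map]) and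
    [mult] restricts to the diagonal ([mult_Map]). With this known, the comonad
    axioms at the identity of [G] say that the operations above form a monoid,
    and the antipode axioms say that this monoid has inverses.

    Conversely, a group provides all these natural transformations. The
    compatibility of [comult] with [mult] then leaves no choice for the
    entwining: if it is precomposition with [(a, b) |-> (p a b, q a b)], the
    compatibility reads [p a b = ab] and [(q a b) b = ab], hence it sends [phi]
    to the map [a, b |-> phi (ab) a]. *)

Section HopfMonadOfGroup.

Variables (G : Sets) (K : group_structure G).

Local Notation H := (Map G).
Local Notation "a * b" := (gmul K a b).
Local Notation "1" := (gone K).

Definition diagonal_mult : nat_trans (comp_functor H H) H :=
  @NatTrans Sets Sets (comp_functor H H) H
    (fun X phi a => phi a a) (fun X Y f => erefl).

Definition constant_unit : nat_trans (id_functor Sets) H :=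
  @NatTrans Sets Sets (id_functor Sets) H
    (fun X x a => x) (fun X Y f => erefl).

Definition diagonal_monad : monad H :=
  {| mult := diagonal_mult;
     unit := constant_unit;
     mult_assoc := fun X => erefl;
     mult_unitl := fun X => erefl;
     mult_unitr := fun X => erefl |}.

Definition product_comult : nat_trans H (comp_functor H H) :=
  @NatTrans Sets Sets H (comp_functor H H)
    (fun X phi a b => phi (a * b)) (fun X Y f => erefl).

Definition one_counit : nat_trans H (id_functor Sets) :=
  @NatTrans Sets Sets H (id_functor Sets)
    (fun X phi => phi 1) (fun X Y f => erefl).

Fact product_comult_coassoc X :
  comp (fmap H (product_comult X)) (product_comult X) =
  comp (product_comult (H X)) (product_comult X).
Proof.
extensionality phi; extensionality a; extensionality b; extensionality c.
by rewrite /= gmulA.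
Qed.

Fact product_comult_counitl X :
  comp (one_counit (H X)) (product_comult X) = idmap (H X).
Proof. by extensionality phi; extensionality a; rewrite /= gmul1g. Qed.

Fact product_comult_counitr X :
  comp (fmap H (one_counit X)) (product_comult X) = idmap (H X).
Proof. by extensionality phi; extensionality a; rewrite /= gmulg1. Qed.

Definition group_comonad : comonad H :=
  {| comult := product_comult;
     counit := one_counit;
     comult_coassoc := product_comult_coassoc;
     comult_counitl := product_comult_counitl;
     comult_counitr := product_comult_counitr |}.

Definition group_entwining :
    nat_trans (comp_functor H H) (comp_functor H H) :=
  @NatTrans Sets Sets (comp_functor H H) (comp_functor H H)
    (fun X phi a b => phi (a * b) a) (fun X Y f => erefl).

Fact group_entwining_law :
  mixed_distributive_law diagonal_monad group_comonad group_entwining.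
Proof.
split=> X //=.
- by extensionality phi; extensionality a; rewrite gmul1g.
- extensionality phi; extensionality a; extensionality b; extensionality c.
  by rewrite gmulA.
Qed.

Definition group_bimonad : bimonad H :=
  {| bimonad_monad := diagonal_monad;
     bimonad_comonad := group_comonad;
     entwining := group_entwining;
     counit_unit := fun X => erefl;
     counit_mult := fun X => erefl;
     comult_unit := fun X => erefl;
     entwining_law := group_entwining_law;
     comult_mult := fun X => erefl |}.

Definition inverse_antipode : nat_trans H H :=
  @NatTrans Sets Sets H H
    (fun X phi a => phi (ginv K a)) (fun X Y f => erefl).

Lemma group_antipode : antipode group_bimonad inverse_antipode.
Proof.
split=> X; extensionality phi; extensionality a.
- by rewrite /= gmulVg.
- by rewrite /= gmulgV.
Qed.

End HopfMonadOfGroup.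

(** Yoneda: [phi] is the image under [fmap F phi] of the identity of [G]. *)
Lemma Map_yoneda (G : Sets) (F : functor Sets Sets)
    (t : nat_trans (Map G) F) (X : Sets) (phi : Map G X) :
  t X phi = fmap F (phi : hom G X) (t G id).
Proof. exact: equal_f (naturality t (phi : hom G X)) id. Qed.

Section MonadOnMap.

Variables (G : Sets) (M : monad (Map G)).

(** Naturality along the constant map with value [x]. *)
Lemma unit_Map (X : Sets) (x : X) (a : G) : unit M X x a = x.
Proof.
exact: equal_f (equal_f (naturality (unit M) ((fun _ => x) : hom X X)) x) a.
Qed.

(** Yoneda for the iterate of [Map G], whose universal element is [pair]. *)
Lemma mult_Map_pair (X : Sets) (phi : G -> G -> X) (a : G) :
  mult M X phi a =
  let: (b, c) := mult M ((G * G)%type : Sets) pair a in phi b c.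
Proof.
pose f : @hom Sets (G * G)%type X := fun bc => let: (b, c) := bc in phi b c.
exact: equal_f (equal_f (naturality (mult M) f) pair) a.
Qed.

(** The two unit laws at the identity of [G] are the counit laws of the
    comonoid on [G]; they say that both coordinates of its
    comultiplication are the identity. *)
Lemma mult_Map (X : Sets) (phi : G -> G -> X) (a : G) :
  mult M X phi a = phi a a.
Proof.
have snd_a : mult M G (unit M (Map G G) id) a = a.
  exact: equal_f (equal_f (mult_unitl M G) id) a.
have fst_a : mult M G (fun b => unit M G b) a = a.
  exact: equal_f (equal_f (mult_unitr M G) id) a.
rewrite mult_Map_pair in snd_a; rewrite mult_Map_pair in fst_a.
rewrite mult_Map_pair; case: (mult M _ pair a) snd_a fst_a => b c.
by rewrite !unit_Map => -> ->.
Qed.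

End MonadOnMap.

Section GroupOfHopfMonad.

Variables (G : Sets) (B : bimonad (Map G)) (S : nat_trans (Map G) (Map G)).
Hypothesis antiS : antipode B S.

Let mul : G -> G -> G := comult B G id.
Let one : G := counit B G id.
Let inv : G -> G := S G id.

Let comultE (X : Sets) (phi : G -> X) a b :
  comult B X phi a b = phi (mul a b).
Proof. by rewrite Map_yoneda. Qed.

Let counitE (X : Sets) (phi : G -> X) : counit B X phi = phi one.
Proof. by rewrite Map_yoneda. Qed.

Let antipodeE (X : Sets) (phi : G -> X) a : S X phi a = phi (inv a).
Proof. by rewrite Map_yoneda. Qed.

Fact comult_assoc : associative mul.
Proof.
move=> a b c; have := equal_f (equal_f (equal_f (equal_f (comult_coassoc B G) id) a) b) c.
by rewrite /= !comultE.
Qed.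

Fact counit_left_id : left_id one mul.
Proof.
move=> a; have := equal_f (equal_f (comult_counitl B G) id) a.
by rewrite /= counitE.
Qed.

Fact counit_right_id : right_id one mul.
Proof.
move=> a; have := equal_f (equal_f (comult_counitr B G) id) a.
by rewrite /= counitE.
Qed.

Fact antipode_left_inverse : left_inverse one inv mul.
Proof.
move=> a; have := equal_f (equal_f (antipodel antiS G) id) a.
by rewrite /= mult_Map antipodeE unit_Map.
Qed.

Fact antipode_right_inverse : right_inverse one inv mul.
Proof.
move=> a; have := equal_f (equal_f (antipoder antiS G) id) a.
by rewrite /= mult_Map antipodeE unit_Map.
Qed.

Definition group_of_antipode : group_structure G :=
  {| gmulA := comult_assoc;
     gmul1g := counit_left_id;
     gmulg1 := counit_right_id;
     gmulVg := antipode_left_inverse;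
     gmulgV := antipode_right_inverse |}.

End GroupOfHopfMonad.

Theorem mainTheorem5 (G : Sets) : is_group G <-> is_hopf_monad (Map G).
Proof.
split=> [[K]|[B [S antiS]]].
- by exists (group_bimonad K), (inverse_antipode K); apply: group_antipode.
- by constructor; apply: group_of_antipode antiS.
Qed.
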